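(* Let $R$ be a regular (commutative Noetherian) ring of prime characteristic $p$, let $n\ge1$, and let $U$ be a triangular subset of $R^n$. Let $\mathcal{M}$ be an $F$-module over $R$ with structural isomorphism $\nu:\mathcal{M}\xrightarrow{\cong}F(\mathcal{M})=R'\otimes_R\mathcal{M}$. Then the module of generalized fractions $U^{-n}\mathcal{M}$ is again an $F$-module, with structural isomorphism $\kappa:U^{-n}\mathcal{M}\xrightarrow{\cong}F(U^{-n}\mathcal{M})=R'\otimes_RU^{-n}\mathcal{M}$ such that $$\kappa\left(\frac{\nu^{-1}\left(\sum_{i=1}^hr_i'\otimes m_i\right)}{(u_1,\ldots,u_n)}\right)=\sum_{i=1}^hu_1^{p-1}\cdots u_n^{p-1}r_i'\otimes\frac{m_i}{(u_1,\ldots,u_n)}$$ for all $(u_1,\ldots,u_n)\in U$, all integers $h\ge1$, all $r_1',\ldots,r_h'\in R$ and all $m_1,\ldots,m_h\in\mathcal{M}$.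
   Context: $F$ denotes the Frobenius functor $R'\otimes_R\bullet$, where $R'$ is $R$ regarded as a left $R$-module naturally and as a right $R$-module via the Frobenius homomorphism $r\mapsto r^p$ (so $r'\otimes rm=r'r^p\otimes m$). An $F$-module is an $R$-module $\mathcal{M}$ equipped with an $R$-isomorphism $\mathcal{M}\to F(\mathcal{M})$, called its structure (or structural) isomorphism. Generalized fractions (over a commutative ring $A$): let $D_n(A)$ be the set of lower triangular $n\times n$ matrices over $A$, and $|\mathbf{H}|$ the determinant of $\mathbf{H}$. A triangular subset of $A^n$ is a non-empty $U\subseteq A^n$ such that (a) $(u_1,\ldots,u_n)\in U$ implies $(u_1^{\alpha_1},\ldots,u_n^{\alpha_n})\in U$ for all positive integers $\alpha_i$; (b) for all $\mathbf{u},\mathbf{v}\in U$ there are $\mathbf{w}\in U$ and $\mathbf{H},\mathbf{K}\in D_n(A)$ with $\mathbf{H}\mathbf{u}^T=\mathbf{w}^T=\mathbf{K}\mathbf{v}^T$. For an $A$-module $M$, define an equivalence relation on $M\times U$ by $(m,\mathbf{u})\sim(g,\mathbf{v})$ iff there are $\mathbf{w}=(w_1,\ldots,w_n)\in U$ and $\mathbf{H},\mathbf{K}\in D_n(A)$ with $\mathbf{H}\mathbf{u}^T=\mathbf{w}^T=\mathbf{K}\mathbf{v}^T$ and $|\mathbf{H}|m-|\mathbf{K}|g\in\sum_{j=1}^{n-1}w_jM$. The class of $(m,\mathbf{u})$ is written $m/\mathbf{u}$, and $U^{-n}M$ is the set of classes, an $A$-module under $m/\mathbf{u}+g/\mathbf{v}=(|\mathbf{H}|m+|\mathbf{K}|g)/\mathbf{w}$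 (for any $\mathbf{w}\in U$, $\mathbf{H},\mathbf{K}\in D_n(A)$ with $\mathbf{H}\mathbf{u}^T=\mathbf{w}^T=\mathbf{K}\mathbf{v}^T$) and $a(m/\mathbf{u})=am/\mathbf{u}$. *)

(* Defs.v *)
From HB Require Import structures.
From mathcomp Require Import all_boot all_order all_algebra.
From mathcomp Require Import ring_quotient generic_quotient.
From mathcomp Require Import boolp.
From mathcomp Require Import ring.

Set Implicit Arguments.
Unset Strict Implicit.
Unset Printing Implicit Defensive.

Import GRing.Theory.
Local Open Scope ring_scope.
Local Open Scope quotient_scope.

Section Localization.
Variables (R : comNzRingType) (P : prime_idealr R).

Definition loc_den := {s : R | s \notin P}.
Local Notation val := (@sval R (fun s => is_true (s \notin P))).

Definition loc_rel (x y : R * loc_den) : bool :=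
  `[< exists2 t : R, t \notin P & t * (val y.2 * x.1 - val x.2 * y.1) = 0 >].

Fact loc_rel_refl : reflexive loc_rel.
Proof.
move=> x; apply/asboolP; exists 1; first by rewrite idealr1.
by rewrite subrr mulr0.
Qed.

Fact loc_rel_sym : symmetric loc_rel.
Proof.
have h x y : loc_rel x y -> loc_rel y x.
  move=> /asboolP[t tP e]; apply/asboolP; exists t => //.
  by rewrite -[LHS]opprK -mulrN opprB e oppr0.
by move=> x y; apply/idP/idP; apply: h.
Qed.

Fact loc_rel_trans : transitive loc_rel.
Proof.
move=> y x z /asboolP[t tP e1] /asboolP[t' tP' e2]; apply/asboolP.
exists (t * t' * val y.2).
  by rewrite !prime_idealrM !negb_or tP tP' (svalP y.2).
transitivity (t' * val z.2 * (t * (val y.2 * x.1 - val x.2 * y.1)) +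
  t * val x.2 * (t' * (val z.2 * y.1 - val y.2 * z.1))); first by ring.
by rewrite e1 e2 !mulr0 addr0.
Qed.

Canonical loc_equiv := EquivRel loc_rel loc_rel_refl loc_rel_sym loc_rel_trans.

Definition localization := {eq_quot loc_equiv}.
HB.instance Definition _ := Choice.on localization.
HB.instance Definition _ := EqQuotient.on localization.

Fact loc_den1_subproof : 1 \notin P. Proof. by rewrite idealr1. Qed.
Definition loc_den1 : loc_den := exist _ 1 loc_den1_subproof.

Fact loc_denM_subproof (s t : loc_den) : val s * val t \notin P.
Proof. by rewrite prime_idealrM negb_or (svalP s) (svalP t). Qed.
Definition loc_denM (s t : loc_den) : loc_den :=
  exist _ (val s * val t) (loc_denM_subproof s t).

Definition loc_frac (a : R) (s : loc_den) : localization :=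
  \pi_localization (a, s).

Lemma loc_fracP a s b t : loc_frac a s = loc_frac b t <->
  exists2 r : R, r \notin P & r * (val t * a - val s * b) = 0.
Proof.
split; first by move=> /eqmodP /asboolP.
by move=> h; apply/eqmodP/asboolP.
Qed.

Lemma loc_frac_eq a s b t : val t * a = val s * b -> loc_frac a s = loc_frac b t.
Proof.
move=> e; apply/loc_fracP; exists 1; first by rewrite idealr1.
by rewrite e subrr mulr0.
Qed.

Lemma locW (Q : localization -> Prop) : (forall a s, Q (loc_frac a s)) -> forall x, Q x.
Proof. by move=> h x; rewrite -[x]reprK; case: (repr x) => a s; apply: h. Qed.

Lemma loc_reprK x : loc_frac (repr x).1 (repr x).2 = x.
Proof. by rewrite /loc_frac -surjective_pairing reprK. Qed.

Definition loc_add (x y : localization) : localization :=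
  loc_frac (val (repr y).2 * (repr x).1 + val (repr x).2 * (repr y).1)
           (loc_denM (repr x).2 (repr y).2).
Definition loc_opp (x : localization) : localization :=
  loc_frac (- (repr x).1) (repr x).2.
Definition loc_mul (x y : localization) : localization :=
  loc_frac ((repr x).1 * (repr y).1) (loc_denM (repr x).2 (repr y).2).

Lemma loc_addE a s b t : loc_add (loc_frac a s) (loc_frac b t) =
  loc_frac (val t * a + val s * b) (loc_denM s t).
Proof.
rewrite /loc_add.
have := loc_reprK (loc_frac a s); case: (repr _) => a' s' /=.
have := loc_reprK (loc_frac b t); case: (repr _) => b' t' /=.
move=> /loc_fracP[r rP e] /loc_fracP[r' rP' e']; apply/loc_fracP.
exists (r * r'); first by rewrite prime_idealrM negb_or rP rP'.
rewrite /=; transitivity (r * val t * val t' * (r' * (val s * a' - val s' * a)) +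
  r' * val s * val s' * (r * (val t * b' - val t' * b))); first by ring.
by rewrite e e' !mulr0 addr0.
Qed.

Lemma loc_oppE a s : loc_opp (loc_frac a s) = loc_frac (- a) s.
Proof.
rewrite /loc_opp.
have := loc_reprK (loc_frac a s); case: (repr _) => a' s' /=.
move=> /loc_fracP[r rP e]; apply/loc_fracP; exists r => //.
by rewrite !mulrN -opprD mulrN e oppr0.
Qed.

Lemma loc_mulE a s b t : loc_mul (loc_frac a s) (loc_frac b t) =
  loc_frac (a * b) (loc_denM s t).
Proof.
rewrite /loc_mul.
have := loc_reprK (loc_frac a s); case: (repr _) => a' s' /=.
have := loc_reprK (loc_frac b t); case: (repr _) => b' t' /=.
move=> /loc_fracP[r rP e] /loc_fracP[r' rP' e']; apply/loc_fracP.
exists (r * r'); first by rewrite prime_idealrM negb_or rP rP'.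
rewrite /=; transitivity (r * val t * b' * (r' * (val s * a' - val s' * a)) +
  r' * a * val s' * (r * (val t * b' - val t' * b))); first by ring.
by rewrite e e' !mulr0 addr0.
Qed.

Fact loc_addA : associative loc_add.
Proof.
elim/locW=> a s; elim/locW=> b t; elim/locW=> c r.
by rewrite !loc_addE; apply: loc_frac_eq => /=; ring.
Qed.
Fact loc_addC : commutative loc_add.
Proof.
elim/locW=> a s; elim/locW=> b t.
by rewrite !loc_addE; apply: loc_frac_eq => /=; ring.
Qed.
Fact loc_add0 : left_id (loc_frac 0 loc_den1) loc_add.
Proof. by elim/locW=> a s; rewrite loc_addE; apply: loc_frac_eq => /=; ring. Qed.
Fact loc_addN : left_inverse (loc_frac 0 loc_den1) loc_opp loc_add.
Proof.
by elim/locW=> a s; rewrite loc_oppE loc_addE; apply: loc_frac_eq => /=; ring.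
Qed.
HB.instance Definition _ :=
  GRing.isZmodule.Build localization loc_addA loc_addC loc_add0 loc_addN.

Fact loc_mulA : associative loc_mul.
Proof.
elim/locW=> a s; elim/locW=> b t; elim/locW=> c r.
by rewrite !loc_mulE; apply: loc_frac_eq => /=; ring.
Qed.
Fact loc_mulC : commutative loc_mul.
Proof.
elim/locW=> a s; elim/locW=> b t.
by rewrite !loc_mulE; apply: loc_frac_eq => /=; ring.
Qed.
Fact loc_mul1 : left_id (loc_frac 1 loc_den1) loc_mul.
Proof. by elim/locW=> a s; rewrite loc_mulE; apply: loc_frac_eq => /=; ring. Qed.
Fact loc_mulD : left_distributive loc_mul loc_add.
Proof.
elim/locW=> a s; elim/locW=> b t; elim/locW=> c r.
by rewrite !(loc_addE, loc_mulE); apply: loc_frac_eq => /=; ring.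
Qed.
Fact loc_one_neq0 : loc_frac 1 loc_den1 != loc_frac 0 loc_den1.
Proof.
apply/eqP => /loc_fracP[r rP] /=; rewrite mulr1 mulr0 subr0 mulr1 => r0.
by rewrite r0 idealr0 in rP.
Qed.
HB.instance Definition _ := GRing.Zmodule_isComNzRing.Build localization
  loc_mulA loc_mulC loc_mul1 loc_mulD loc_one_neq0.

End Localization.

Section RegularRings.
Variable R : comNzRingType.

Definition generated_by (I : {pred R}) (s : seq R) : Prop :=
  forall x, x \in I <->
    exists c : 'I_(size s) -> R, x = \sum_(i < size s) c i * s`_i.

(* [idealr R] is the type of proper ideals; the unit ideal is generated by 1. *)
Definition noetherian : Prop :=
  forall I : idealr R, exists s : seq R, generated_by I s.

Definition maximal_ideal (m : idealr R) : Prop :=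
  forall I : idealr R, {subset m <= I} -> I =i m.

Definition prime_chain (d : nat) (P : 'I_d.+1 -> prime_idealr R) : Prop :=
  forall i j : 'I_d.+1, (i < j)%N ->
    {subset P i <= P j} /\ ~ {subset P j <= P i}.

Definition krull_dim_eq (d : nat) : Prop :=
  (exists P : 'I_d.+1 -> prime_idealr R, prime_chain P) /\
  (forall (k : nat) (P : 'I_k.+1 -> prime_idealr R), prime_chain P -> (k <= d)%N).

Definition regular_local : Prop :=
  noetherian /\
  exists m : idealr R,
    [/\ maximal_ideal m,
        forall m' : idealr R, maximal_ideal m' -> m' =i m
      & exists s : seq R, generated_by m s /\ krull_dim_eq (size s)].

End RegularRings.

Definition regular_ring (R : comNzRingType) : Prop :=
  noetherian R /\ forall P : prime_idealr R, regular_local (localization P).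

Section BaseChange.
Variables (R S : comNzRingType) (phi : {rmorphism R -> S}) (M : lmodType R).

(* A formal sum of pure tensors is a list; the tensor product S (x)_R M, with
   S a right R-module through phi, is the free commutative monoid on S * M
   modulo the congruence generated by biadditivity and balancedness. *)
Inductive tensor_rel : seq (S * M) -> seq (S * M) -> Prop :=
| TensorRefl x : tensor_rel x x
| TensorSym x y : tensor_rel x y -> tensor_rel y x
| TensorTrans x y z : tensor_rel x y -> tensor_rel y z -> tensor_rel x z
| TensorCat x x' y y' :
    tensor_rel x x' -> tensor_rel y y' -> tensor_rel (x ++ y) (x' ++ y')
| TensorComm x y : tensor_rel (x ++ y) (y ++ x)
| Tensor0 m : tensor_rel [:: (0, m)] [::]
| TensorDl s s' m : tensor_rel [:: (s + s', m)] [:: (s, m); (s', m)]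
| TensorDr s m m' : tensor_rel [:: (s, m + m')] [:: (s, m); (s, m')]
| TensorBal s r m : tensor_rel [:: (s * phi r, m)] [:: (s, r *: m)].

Definition tensor_relb (x y : seq (S * M)) : bool := `[< tensor_rel x y >].

Fact tensor_relb_refl : reflexive tensor_relb.
Proof. by move=> x; apply/asboolP; apply: TensorRefl. Qed.
Fact tensor_relb_sym : symmetric tensor_relb.
Proof. by move=> x y; apply/asboolP/asboolP; apply: TensorSym. Qed.
Fact tensor_relb_trans : transitive tensor_relb.
Proof.
move=> y x z /asboolP xy /asboolP yz; apply/asboolP.
exact: TensorTrans xy yz.
Qed.
Canonical tensor_equiv :=
  EquivRel tensor_relb tensor_relb_refl tensor_relb_sym tensor_relb_trans.

Definition base_change := {eq_quot tensor_equiv}.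
HB.instance Definition _ := Choice.on base_change.
HB.instance Definition _ := EqQuotient.on base_change.

Definition tensor_sum (x : seq (S * M)) : base_change := \pi_base_change x.

Definition tensor (s : S) (m : M) : base_change := tensor_sum [:: (s, m)].

Lemma tensor_sumP x y : tensor_sum x = tensor_sum y <-> tensor_rel x y.
Proof.
split; first by move=> /eqmodP /asboolP.
by move=> h; apply/eqmodP/asboolP.
Qed.

Lemma tensor_repr x : tensor_rel (repr (tensor_sum x)) x.
Proof. by apply/tensor_sumP; rewrite /tensor_sum reprK. Qed.

Lemma tensor_sumW (Q : base_change -> Prop) :
  (forall x, Q (tensor_sum x)) -> forall x, Q x.
Proof. by move=> h x; rewrite -[x]reprK; apply: h. Qed.

Definition tensor_smap (a : S) (x : seq (S * M)) : seq (S * M) :=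
  [seq (a * z.1, z.2) | z <- x].

Lemma tensor_smap_rel a x y :
  tensor_rel x y -> tensor_rel (tensor_smap a x) (tensor_smap a y).
Proof.
elim=> {x y} [x|x y _|x y z _ h1 _|x x' y y' _ h1 _ h2|x y|m|s s' m|s m m'|s r m].
- exact: TensorRefl.
- exact: TensorSym.
- exact: TensorTrans h1.
- by rewrite /tensor_smap !map_cat; apply: TensorCat.
- by rewrite /tensor_smap !map_cat; apply: TensorComm.
- by rewrite /= mulr0; apply: Tensor0.
- by rewrite /= mulrDr; apply: TensorDl.
- exact: TensorDr.
- by rewrite /= mulrA; apply: TensorBal.
Qed.

Definition tensor_add (x y : base_change) : base_change :=
  tensor_sum (repr x ++ repr y).
Definition tensor_scale (a : S) (x : base_change) : base_change :=
  tensor_sum (tensor_smap a (repr x)).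
Definition tensor_opp (x : base_change) : base_change := tensor_scale (-1) x.

Lemma tensor_addE x y :
  tensor_add (tensor_sum x) (tensor_sum y) = tensor_sum (x ++ y).
Proof. by apply/tensor_sumP; apply: TensorCat; apply: tensor_repr. Qed.

Lemma tensor_scaleE a x :
  tensor_scale a (tensor_sum x) = tensor_sum (tensor_smap a x).
Proof. by apply/tensor_sumP; apply: tensor_smap_rel; apply: tensor_repr. Qed.

Fact tensor_addA : associative tensor_add.
Proof.
elim/tensor_sumW=> x; elim/tensor_sumW=> y; elim/tensor_sumW=> z.
by rewrite !tensor_addE catA.
Qed.
Fact tensor_addC : commutative tensor_add.
Proof.
elim/tensor_sumW=> x; elim/tensor_sumW=> y; rewrite !tensor_addE.
by apply/tensor_sumP; apply: TensorComm.
Qed.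
Fact tensor_add0 : left_id (tensor_sum [::]) tensor_add.
Proof. by elim/tensor_sumW=> x; rewrite tensor_addE. Qed.

Lemma tensor_scaleDr a : {morph tensor_scale a : x y / tensor_add x y}.
Proof.
elim/tensor_sumW=> x; elim/tensor_sumW=> y.
by rewrite !(tensor_addE, tensor_scaleE) /tensor_smap map_cat.
Qed.

Lemma tensor_consE z x :
  tensor_sum (z :: x) = tensor_add (tensor_sum [:: z]) (tensor_sum x).
Proof. by rewrite tensor_addE. Qed.

Lemma tensor_ind (Q : base_change -> Prop) : Q (tensor_sum [::]) ->
  (forall s m, Q (tensor s m)) ->
  (forall x y, Q x -> Q y -> Q (tensor_add x y)) -> forall x, Q x.
Proof.
move=> Q0 Qt QD; elim/tensor_sumW => x.
elim: x => [|[s m] x IH]; first exact: Q0.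
by rewrite tensor_consE; apply: (QD _ _ (Qt s m) IH).
Qed.

Lemma tensor_scaleT a s m : tensor_scale a (tensor s m) = tensor (a * s) m.
Proof. by rewrite tensor_scaleE. Qed.

Lemma tensor_scale_nil a : tensor_scale a (tensor_sum [::]) = tensor_sum [::].
Proof. by rewrite tensor_scaleE. Qed.

Lemma tensor_addACA : interchange tensor_add tensor_add.
Proof.
move=> a b c d; rewrite -!tensor_addA; congr tensor_add.
by rewrite !tensor_addA [tensor_add b c]tensor_addC.
Qed.

Lemma tensor_scaleDl a b x :
  tensor_scale (a + b) x = tensor_add (tensor_scale a x) (tensor_scale b x).
Proof.
elim/tensor_ind: x => [|s m|x y hx hy].
- by rewrite !tensor_scale_nil tensor_add0.
- rewrite !tensor_scaleT mulrDl tensor_addE.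
  by apply/tensor_sumP; apply: TensorDl.
- by rewrite !tensor_scaleDr hx hy tensor_addACA.
Qed.

Lemma tensor_scale0 x : tensor_scale 0 x = tensor_sum [::].
Proof.
elim/tensor_ind: x => [|s m|x y hx hy].
- exact: tensor_scale_nil.
- by rewrite tensor_scaleT mul0r; apply/tensor_sumP; apply: Tensor0.
- by rewrite tensor_scaleDr hx hy tensor_add0.
Qed.

Fact tensor_scale1 : left_id 1 tensor_scale.
Proof.
move=> x; elim/tensor_ind: x => [|s m|x y hx hy].
- exact: tensor_scale_nil.
- by rewrite tensor_scaleT mul1r.
- by rewrite tensor_scaleDr hx hy.
Qed.

Fact tensor_scaleA a b x :
  tensor_scale a (tensor_scale b x) = tensor_scale (a * b) x.
Proof.
elim/tensor_ind: x => [|s m|x y hx hy].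
- by rewrite !tensor_scale_nil.
- by rewrite !tensor_scaleT mulrA.
- by rewrite !tensor_scaleDr hx hy.
Qed.

Fact tensor_addN : left_inverse (tensor_sum [::]) tensor_opp tensor_add.
Proof.
move=> x; rewrite /tensor_opp -{2}[x]tensor_scale1 -tensor_scaleDl addNr.
exact: tensor_scale0.
Qed.

HB.instance Definition _ := GRing.isZmodule.Build base_change
  tensor_addA tensor_addC tensor_add0 tensor_addN.

HB.instance Definition _ := GRing.Zmodule_isLmodule.Build S base_change
  tensor_scaleA tensor_scale1 tensor_scaleDr (fun x a b => tensor_scaleDl a b x).

Lemma tensorDl s s' m : tensor (s + s') m = tensor s m + tensor s' m.
Proof. by rewrite [RHS]tensor_addE; apply/tensor_sumP; apply: TensorDl. Qed.

Lemma tensorDr s m m' : tensor s (m + m') = tensor s m + tensor s m'.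
Proof. by rewrite [RHS]tensor_addE; apply/tensor_sumP; apply: TensorDr. Qed.

Lemma tensor_bal s r m : tensor (s * phi r) m = tensor s (r *: m).
Proof. by apply/tensor_sumP; apply: TensorBal. Qed.

Lemma tensorZ a s m : a *: tensor s m = tensor (a * s) m.
Proof. exact: tensor_scaleT. Qed.

End BaseChange.

Section FrobeniusFunctor.
Variables (R : comNzRingType) (p : nat) (charRp : p \in [pchar R]).

Definition frobenius_functor (M : lmodType R) : lmodType R :=
  base_change (pFrobenius_aut charRp) M.

Definition frobenius_tensor (M : lmodType R) (r : R) (m : M) :
  frobenius_functor M := tensor (pFrobenius_aut charRp) r m.

Lemma frobenius_tensor_bal (M : lmodType R) (r a : R) (m : M) :
  frobenius_tensor (r * a ^+ p) m = frobenius_tensor r (a *: m).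
Proof. exact: tensor_bal. Qed.

Record F_structure (M : lmodType R) := FStructure {
  F_iso :> {linear M -> frobenius_functor M};
  F_inv : frobenius_functor M -> M;
  F_isoK : cancel F_iso F_inv;
  F_invK : cancel F_inv F_iso }.

End FrobeniusFunctor.


Section TriangularMatrices.
Variables (R : comNzRingType) (n : nat).
Implicit Types (M : lmodType R) (H K : 'M[R]_n) (u v w z : 'cV[R]_n).

Lemma trig1 : is_trig_mx (1%:M : 'M[R]_n).
Proof. exact: scalar_mx_is_trig. Qed.

Lemma trigM H K : is_trig_mx H -> is_trig_mx K -> is_trig_mx (H *m K).
Proof.
move=> /is_trig_mxP hH /is_trig_mxP hK; apply/is_trig_mxP => i j ij.
rewrite mxE big1 // => k _; case: (ltnP i k) => [ik|ki].
  by rewrite hH // mul0r.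
by rewrite hK ?mulr0 // (leq_ltn_trans ki).
Qed.

(* [in_span Q w x]: x belongs to the sum of the w_j M over the j such that Q j *)
Definition in_span (M : lmodType R) (Q : pred 'I_n) (w : 'cV[R]_n) (x : M) : Prop :=
  exists b : 'I_n -> M, x = \sum_(j < n | Q j) w j 0 *: b j.

Lemma in_span0 M Q w : in_span Q w (0 : M).
Proof. by exists (fun=> 0); rewrite big1 // => j _; rewrite scaler0. Qed.

Lemma in_spanD M Q w (x y : M) : in_span Q w x -> in_span Q w y -> in_span Q w (x + y).
Proof.
move=> [b ->] [c ->]; exists (fun j => b j + c j); rewrite -big_split /=.
by apply: eq_bigr => j _; rewrite scalerDr.
Qed.

Lemma in_spanZ M Q w a (x : M) : in_span Q w x -> in_span Q w (a *: x).
Proof.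
move=> [b ->]; exists (fun j => a *: b j); rewrite scaler_sumr.
by apply: eq_bigr => j _; rewrite !scalerA mulrC.
Qed.

Lemma in_spanN M Q w (x : M) : in_span Q w x -> in_span Q w (- x).
Proof. by rewrite -scaleN1r; apply: in_spanZ. Qed.

Lemma in_span_sum M Q w I (r : seq I) (T : pred I) (F : I -> M) :
  (forall i, T i -> in_span Q w (F i)) -> in_span Q w (\sum_(i <- r | T i) F i).
Proof.
move=> h; elim/big_rec: _ => [|i x Ti hx]; first exact: in_span0.
by apply: in_spanD => //; apply: h.
Qed.

Lemma in_span_gen M (Q : pred 'I_n) w j (x : M) : Q j -> in_span Q w (w j 0 *: x).
Proof.
move=> Qj; exists (fun i => if i == j then x else 0).
rewrite (bigD1 j) //= eqxx big1 ?addr0 // => i /andP[_ /negPf->].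
by rewrite scaler0.
Qed.

Lemma in_spanS M (Q Q' : pred 'I_n) w (x : M) :
  (forall j, Q j -> Q' j) -> in_span Q w x -> in_span Q' w x.
Proof.
by move=> h [b ->]; apply: in_span_sum => j /h Qj; apply: in_span_gen.
Qed.

Lemma in_span_scale M Q w (a : R^o) (x : M) : in_span Q w a -> in_span Q w (a *: x).
Proof.
move=> [b ->]; rewrite scaler_suml; apply: in_span_sum => j Qj.
by rewrite -scalerA; apply: in_span_gen.
Qed.

Lemma trig_row H u j : is_trig_mx H ->
  (H *m u) j 0 = \sum_(i < n | (i < j)%N) H j i * u i 0 + H j j * u j 0.
Proof.
move=> /is_trig_mxP hH; rewrite mxE (bigID (fun i : 'I_n => (i < j)%N)) /=.
congr (_ + _); rewrite (bigD1 j) ?ltnn //= big1 ?addr0 // => i.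
rewrite -leqNgt => /andP[ji nij]; rewrite hH ?mul0r //.
by rewrite ltn_neqAle ji andbT eq_sym.
Qed.

Lemma trig_prod_span H u (j : 'I_n) : is_trig_mx H ->
  in_span (fun i : 'I_n => (i <= j)%N) (H *m u)
    ((\prod_(l < n | (l <= j)%N) H l l) * u j 0 : R^o).
Proof.
move=> hH; case: j => j jn /=.
elim/ltn_ind: j jn => j IH jn; set j' := Ordinal jn.
rewrite (bigD1 j') ?leqnn //= -mulrA [X in _ * X]mulrC mulrA.
have -> : H j' j' * u j' 0 =
    (H *m u) j' 0 - \sum_(i < n | (i < j)%N) H j' i * u i 0.
  by rewrite trig_row // [X in X - _]addrC addrK.
rewrite mulrBl; apply: in_spanD; first by apply: (@in_span_gen R^o); rewrite /= leqnn.
apply: in_spanN; rewrite mulr_suml; apply: in_span_sum => -[i ilt] /= ij.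
have -> : \prod_(l < n | (l <= j)%N && (l != j')) H l l =
    (\prod_(l < n | (l <= i)%N) H l l) *
    (\prod_(l < n | (l <= j)%N && (l != j') && ~~ (l <= i)%N) H l l).
  rewrite (bigID (fun l : 'I_n => (l <= i)%N)) /=; congr (_ * _).
  apply: eq_bigl => l; rewrite andb_idl // => li; apply/andP; split.
    by rewrite (leq_trans li) // ltnW.
  by rewrite -val_eqE /= ltn_eqF // (leq_ltn_trans li).
set A := \prod_(_ < _ | _) _; set B := \prod_(_ < _ | _) _.
set y := u _ _; set x := H _ _.
have -> : x * y * (A * B) = (x * B) *: (A * y : R^o) by rewrite /GRing.scale /=; ring.
apply: in_spanZ; apply: in_spanS (IH i ij ilt) => l /= li.
by rewrite (leq_trans li) // ltnW.
Qed.

(* the submodule sum_(j < n) w_j M, with j ranging over all indices but the last *)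
Definition notlast : pred 'I_n := [pred j : 'I_n | (j.+1 < n)%N].

Lemma trig_span M H u (x : M) : is_trig_mx H ->
  in_span notlast u x -> in_span notlast (H *m u) (\det H *: x).
Proof.
move=> hH [b ->]; rewrite scaler_sumr; apply: in_span_sum => j jn.
rewrite det_trig // (bigID (fun l : 'I_n => (l <= j)%N)) /= scalerA.
rewrite -mulrA [X in _ * X]mulrC mulrA mulrC -scalerA; apply: in_spanZ.
rewrite -/(GRing.scale _ _); apply: in_span_scale.
apply: in_spanS (trig_prod_span u j hH) => i ij.
exact: (@leq_ltn_trans j.+1 i.+1 n).
Qed.

Definition diag w : 'M[R]_n := diag_mx w^T.
Definition sqr_vec w : 'cV[R]_n := \col_i w i 0 ^+ 2.

Lemma trig_diag w : is_trig_mx (diag w).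
Proof. exact: diag_mx_is_trig. Qed.

Lemma diag_mul w : diag w *m w = sqr_vec w.
Proof.
apply/matrixP => i j; rewrite ord1 mul_diag_mx !mxE.
by rewrite expr2.
Qed.

Lemma det_diagE w : \det (diag w) = \prod_i w i 0.
Proof. by rewrite det_diag; apply: eq_bigr => i _; rewrite mxE. Qed.

Lemma span_sqr (Q T : pred 'I_n) w (x : R^o) : (forall j, Q j -> T j) ->
  in_span Q w x -> in_span Q (sqr_vec w) ((\prod_(i < n | T i) w i 0) * x : R^o).
Proof.
move=> QT [b ->]; rewrite mulr_sumr; apply: in_span_sum => j Qj.
rewrite (bigD1 j) ?QT //=; set A := \prod_(_ < _ | _) _.
have -> : w j 0 * A * (w j 0 *: b j) = sqr_vec w j 0 *: (A * b j : R^o).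
  by rewrite mxE /GRing.scale /=; ring.
exact: in_span_gen.
Qed.

Lemma trig_two_span H K u w : is_trig_mx H -> is_trig_mx K ->
    H *m u = w -> K *m u = w -> forall k, (k <= n)%N ->
  in_span (fun j : 'I_n => (j.+1 < k)%N) (sqr_vec w)
    ((\prod_(i < n | (i < k)%N) w i 0) *
     (\prod_(i < n | (i < k)%N) H i i - \prod_(i < n | (i < k)%N) K i i) : R^o).
Proof.
move=> hH hK Hu Ku; elim=> [|k IH] kn.
  by rewrite !big_pred0 // subrr mulr0; apply: in_span0.
pose k' := Ordinal kn.
have step (F : 'I_n -> R) : \prod_(i < n | (i < k.+1)%N) F i =
    F k' * \prod_(i < n | (i < k)%N) F i.
  rewrite (bigD1 k') ?ltnSn //=; congr (_ * _); apply: eq_bigl => i.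
  by rewrite ltnS ltn_neqAle andbC.
rewrite !step.
set Z := \prod_(i < n | _) w i 0 in IH *.
set A := \prod_(i < n | _) H i i in IH *.
set B := \prod_(i < n | _) K i i in IH *.
have -> : w k' 0 * Z * (H k' k' * A - K k' k' * B) =
    (w k' 0 * H k' k') *: (Z * (A - B) : R^o) +
    (Z * (B * ((H k' k' - K k' k') * w k' 0))).
  by rewrite /GRing.scale /=; ring.
apply: in_spanD.
  apply: in_spanZ; apply: in_spanS (IH (ltnW kn)) => j /= jk.
  exact: ltnW.
have -> : (H k' k' - K k' k') * w k' 0 =
    \sum_(i < n | (i < k)%N)
      ((H k' k' - K k' k') * K k' i - K k' k' * (H k' i - K k' i)) * u i 0.
  have eH := trig_row u k' hH; rewrite Hu in eH.
  have eK := trig_row u k' hK; rewrite Ku in eK.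
  have -> : \sum_(i < n | (i < k)%N)
      ((H k' k' - K k' k') * K k' i - K k' k' * (H k' i - K k' i)) * u i 0 =
    (H k' k' - K k' k') * (\sum_(i < n | (i < k)%N) K k' i * u i 0) -
    K k' k' * (\sum_(i < n | (i < k)%N) H k' i * u i 0
               - \sum_(i < n | (i < k)%N) K k' i * u i 0).
    rewrite -sumrB !mulr_sumr -sumrB; apply: eq_bigr => i _; ring.
  move: eH eK => /=; set sH := \sum_(_ < _ | _) H _ _ * _.
  set sK := \sum_(_ < _ | _) K _ _ * _ => eH eK.
  have -> : sK = w k' 0 - K k' k' * u k' 0 by rewrite eK addrK.
  have -> : sH = w k' 0 - H k' k' * u k' 0 by rewrite eH addrK.
  ring.
rewrite mulr_sumr mulr_sumr; apply: in_span_sum => i ik.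
set c := _ - _.
have -> : Z * (B * (c * u i 0)) = c *: (Z * (B * u i 0) : R^o).
  by rewrite /GRing.scale /=; ring.
apply: in_spanZ.
apply: (@span_sqr (fun j : 'I_n => (j < k)%N) (fun j : 'I_n => (j < k)%N)) => //.
have -> : B = (\prod_(l < n | (l <= i)%N) K l l) *
    (\prod_(l < n | (l < k)%N && ~~ (l <= i)%N) K l l).
  rewrite /B (bigID (fun l : 'I_n => (l <= i)%N)) /=; congr (_ * _).
  by apply: eq_bigl => l; rewrite andb_idl // => li; apply: leq_ltn_trans ik.
set C := \prod_(_ < _ | _) _; set E := \prod_(_ < _ | _) _.
have -> : C * E * u i 0 = E *: (C * u i 0 : R^o) by rewrite /GRing.scale /=; ring.
apply: in_spanZ; rewrite -Ku; apply: in_spanS (trig_prod_span u i hK) => j /= ji.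
exact: leq_ltn_trans ik.
Qed.

Lemma trig_two_det M H K u w (x : M) : is_trig_mx H -> is_trig_mx K ->
    H *m u = w -> K *m u = w ->
  in_span notlast (diag w *m w) (\det (diag w) *: (\det H *: x - \det K *: x)).
Proof.
move=> hH hK Hu Ku; rewrite diag_mul det_diagE -scalerBl scalerA.
apply: in_span_scale; have := trig_two_span hH hK Hu Ku (leqnn n).
have e (F : 'I_n -> R) : \prod_(i < n | (i < n)%N) F i = \prod_i F i.
  by apply: eq_bigl => i; rewrite ltn_ord.
by rewrite !e !det_trig.
Qed.

End TriangularMatrices.

(* Elements of R^n are column vectors, so that H u^T is H *m u; is_trig_mx means
   lower triangular. *)
Record triangular_set (R : comNzRingType) (n : nat) := TriangularSet {
  tri_set :> 'cV[R]_n -> Prop;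
  tri_nonempty : exists u, tri_set u;
  tri_pow : forall u, tri_set u -> forall a : 'I_n -> nat,
    (forall i, (0 < a i)%N) -> tri_set (\col_i u i 0 ^+ a i);
  tri_directed : forall u v, tri_set u -> tri_set v ->
    exists (w : 'cV[R]_n) (H K : 'M[R]_n),
      [/\ tri_set w, is_trig_mx H, is_trig_mx K, H *m u = w & K *m v = w] }.

Section GeneralizedFractions.
Variables (R : comNzRingType) (n : nat) (U : triangular_set R n) (M : lmodType R).

Definition tri_elt := {u : 'cV[R]_n | `[< U u >]}.

Lemma tri_eltP (u : tri_elt) : U (val u).
Proof. exact/asboolP/(valP u). Qed.

Definition to_elt (u : 'cV[R]_n) (uU : U u) : tri_elt :=
  exist _ u (introT (asboolP _) uU).

Definition gfrac_rel (x y : M * tri_elt) : bool :=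
  `[< exists (w : 'cV[R]_n) (H K : 'M[R]_n),
        [/\ U w, is_trig_mx H /\ is_trig_mx K,
            H *m val x.2 = w, K *m val y.2 = w
          & exists b : 'I_n -> M, \det H *: x.1 - \det K *: y.1 =
              \sum_(j < n | (j.+1 < n)%N) w j 0 *: b j] >].

(* when U w, this says that the fraction m / w is zero *)
Definition gfrac_null (m : M) (w : 'cV[R]_n) : Prop :=
  exists A : 'M[R]_n,
    [/\ is_trig_mx A, U (A *m w) & in_span (@notlast n) (A *m w) (\det A *: m)].

Lemma tri_diag w : U w -> U (diag w *m w).
Proof. by rewrite diag_mul => wU; apply: (tri_pow wU (a := fun=> 2)). Qed.

Lemma gfrac_null_push m w G : is_trig_mx G -> U (G *m w) ->
  gfrac_null (\det G *: m) (G *m w) <-> gfrac_null m w.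
Proof.
move=> hG GU; split=> [[A []]|[A [hA AU mA]]].
  rewrite mulmxA scalerA -det_mulmx => hA AU mA.
  by exists (A *m G); split=> //; apply: trigM.
have [z [B [C [zU hB hC Bz Cz]]]] := tri_directed AU GU.
exists (diag z *m C); rewrite mulmxA -!mulmxA Cz.
split; [by apply: trigM => //; apply: trig_diag | exact: tri_diag | ].
rewrite det_mulmx -scalerA.
have -> : \det C *: (\det G *: m) = \det (B *m A) *: m +
    (\det (C *m G) *: m - \det (B *m A) *: m).
  by rewrite addrC subrK scalerA det_mulmx.
rewrite scalerDr; apply: in_spanD.
  apply: trig_span; first exact: trig_diag.
  by rewrite det_mulmx -scalerA -Bz; apply: trig_span.
apply: (trig_two_det (u := w)); rewrite -?mulmxA //; exact: trigM.
Qed.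

Lemma gfrac_null_span m w : U w -> in_span (@notlast n) w m -> gfrac_null m w.
Proof.
move=> wU mw; exists 1%:M; rewrite mul1mx det1 scale1r; split=> //.
Qed.

Lemma gfrac_nullD m m' w : gfrac_null m w -> gfrac_null m' w -> gfrac_null (m + m') w.
Proof.
move=> [A [hA AU mA]] m'0.
have hD := trig_diag (A *m w); have DU := tri_diag AU.
apply/(gfrac_null_push _ hA AU)/(gfrac_null_push _ hD DU).
have [B [hB BU mB]] :
    gfrac_null (\det (diag (A *m w)) *: (\det A *: m')) (diag (A *m w) *m (A *m w)).
  exact/(gfrac_null_push _ hD DU)/(gfrac_null_push _ hA AU).
exists B; split=> //; rewrite !scalerDr; apply: in_spanD => //.
by do 2?apply: trig_span.
Qed.

Lemma gfrac_nullZ a m w : gfrac_null m w -> gfrac_null (a *: m) w.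
Proof.
move=> [A [hA AU mA]]; exists A; split=> //.
by rewrite scalerA mulrC -scalerA; apply: in_spanZ.
Qed.

Lemma gfrac_null_two H K m w u : U w -> is_trig_mx H -> is_trig_mx K ->
  H *m u = w -> K *m u = w -> gfrac_null (\det H *: m - \det K *: m) w.
Proof.
move=> wU hH hK Hu Ku; exists (diag w); split; first exact: trig_diag.
  exact: tri_diag.
exact: trig_two_det Hu Ku.
Qed.

Lemma gfrac_relI x y w H K : U w -> is_trig_mx H -> is_trig_mx K ->
  H *m val x.2 = w -> K *m val y.2 = w ->
  gfrac_null (\det H *: x.1 - \det K *: y.1) w -> gfrac_rel x y.
Proof.
move=> wU hH hK Hw Kw [A [hA AU [b eb]]].
apply/asboolP; exists (A *m w), (A *m H), (A *m K); split=> //.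
- by split; apply: trigM.
- by rewrite -mulmxA Hw.
- by rewrite -mulmxA Kw.
by exists b; rewrite !det_mulmx -!scalerA -scalerBr.
Qed.

Lemma gfrac_relP x y : gfrac_rel x y <-> forall (w : 'cV[R]_n) (H K : 'M[R]_n),
  U w -> is_trig_mx H -> is_trig_mx K -> H *m val x.2 = w -> K *m val y.2 = w ->
  gfrac_null (\det H *: x.1 - \det K *: y.1) w.
Proof.
split=> [/asboolP[w [H [K [wU [hH hK] Hw Kw e]]]]|h].
  move=> w' H' K' wU' hH' hK' Hw' Kw'.
  have [z [A [B [zU hA hB Az Bz]]]] := tri_directed wU wU'.
  have BU : U (B *m w') by rewrite Bz.
  apply/(gfrac_null_push _ hB BU); rewrite Bz.
  have -> : \det B *: (\det H' *: x.1 - \det K' *: y.1) =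
     \det A *: (\det H *: x.1 - \det K *: y.1) +
     ((\det (B *m H') *: x.1 - \det (A *m H) *: x.1) +
      (-1) *: (\det (B *m K') *: y.1 - \det (A *m K) *: y.1)).
    rewrite scaleN1r !det_mulmx -!scalerA !scalerBr.
    set a := _ *: _; set b := _ *: _; set c := _ *: _; set d := _ *: _.
    by rewrite opprB [a - c + _]addrC addrA [c - d + _]addrA subrK [RHS]addrC addrA subrK.
  apply: gfrac_nullD.
    by rewrite -Az; apply/gfrac_null_push; rewrite ?Az //; apply: gfrac_null_span.
  apply: gfrac_nullD; last apply: gfrac_nullZ.
    by apply: (@gfrac_null_two _ _ _ _ (val x.2)); rewrite -?mulmxA ?Hw' ?Hw //; apply: trigM.
  by apply: (@gfrac_null_two _ _ _ _ (val y.2)); rewrite -?mulmxA ?Kw' ?Kw //; apply: trigM.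
have [w [H [K [wU hH hK Hw Kw]]]] := tri_directed (tri_eltP x.2) (tri_eltP y.2).
by apply: (gfrac_relI wU hH hK Hw Kw); apply: h.
Qed.

Fact gfrac_rel_refl : reflexive gfrac_rel.
Proof.
move=> x; apply: (gfrac_relI (tri_eltP x.2) (trig1 _ _) (trig1 _ _)).
- exact: mul1mx.
- exact: mul1mx.
by rewrite subrr; apply: (gfrac_null_span (tri_eltP x.2)); apply: in_span0.
Qed.

Fact gfrac_rel_sym : symmetric gfrac_rel.
Proof.
have h x y : gfrac_rel x y -> gfrac_rel y x.
  move=> /gfrac_relP xy; apply/gfrac_relP => w H K wU hH hK Hw Kw.
  rewrite -opprB -scaleN1r; apply: gfrac_nullZ; exact: xy.
by move=> x y; apply/idP/idP; apply: h.
Qed.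

Fact gfrac_rel_trans : transitive gfrac_rel.
Proof.
move=> y x z /gfrac_relP xy /gfrac_relP yz.
have [w [H [K [wU hH hK Hw Kw]]]] := tri_directed (tri_eltP x.2) (tri_eltP y.2).
have [w' [H' [K' [wU' hH' hK' Hw' Kw']]]] :=
  tri_directed (tri_eltP y.2) (tri_eltP z.2).
have [t [A [B [tU hA hB At Bt]]]] := tri_directed wU wU'.
have hAH := trigM hA hH; have hAK := trigM hA hK.
have hBH := trigM hB hH'; have hBK := trigM hB hK'.
have eAH : A *m H *m val x.2 = t by rewrite -mulmxA Hw.
have eAK : A *m K *m val y.2 = t by rewrite -mulmxA Kw.
have eBH : B *m H' *m val y.2 = t by rewrite -mulmxA Hw'.
have eBK : B *m K' *m val z.2 = t by rewrite -mulmxA Kw'.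
apply: (gfrac_relI tU hAH hBK eAH eBK).
set a := _ *: _; set d := _ *: _.
pose b := \det (A *m K) *: y.1; pose c := \det (B *m H') *: y.1.
have -> : a - d = (a - b) + ((b - c) + (c - d)) by rewrite !addrA !subrK.
apply: gfrac_nullD; first exact: xy.
apply: gfrac_nullD; last exact: yz.
exact: (gfrac_null_two _ tU hAK hBH eAK eBH).
Qed.

Canonical gfrac_equiv :=
  EquivRel gfrac_rel gfrac_rel_refl gfrac_rel_sym gfrac_rel_trans.

Definition gen_fractions := {eq_quot gfrac_equiv}.
HB.instance Definition _ := Choice.on gen_fractions.
HB.instance Definition _ := EqQuotient.on gen_fractions.

Definition gfrac (m : M) (u : tri_elt) : gen_fractions := \pi_gen_fractions (m, u).

Lemma gfrac_eqP m u g v : gfrac m u = gfrac g v <-> gfrac_rel (m, u) (g, v).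
Proof. by split=> [/eqmodP|h] //; apply/eqmodP. Qed.

Lemma gfrac_push m (u w : tri_elt) H : is_trig_mx H -> H *m val u = val w ->
  gfrac m u = gfrac (\det H *: m) w.
Proof.
move=> hH Hu; apply/gfrac_eqP.
apply: (@gfrac_relI (m, u) (_, w) (val w) H 1%:M) => //.
- exact: tri_eltP.
- exact: mul1mx.
rewrite det1 scale1r subrr.
by apply: (gfrac_null_span (tri_eltP w)); apply: in_span0.
Qed.

Lemma gfrac_sameP m g w : gfrac m w = gfrac g w <-> gfrac_null (m - g) (val w).
Proof.
split=> [/gfrac_eqP/gfrac_relP|h].
  move=> /(_ _ _ _ (tri_eltP w) (trig1 _ _) (trig1 _ _) (mul1mx _) (mul1mx _)).
  by rewrite det1 !scale1r.
apply/gfrac_eqP.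
apply: (@gfrac_relI (m, w) (g, w) (val w) 1%:M 1%:M); rewrite ?mul1mx //.
  exact: tri_eltP.
by rewrite det1 !scale1r.
Qed.

Lemma gfrac_reprK q : gfrac (repr q).1 (repr q).2 = q.
Proof. by rewrite /gfrac -surjective_pairing reprK. Qed.

Lemma tri_elt_directed (u v : tri_elt) :
  {t : tri_elt * 'M[R]_n * 'M[R]_n |
    [/\ is_trig_mx t.1.2, is_trig_mx t.2,
        t.1.2 *m val u = val t.1.1 & t.2 *m val v = val t.1.1]}.
Proof.
apply: cid.
have [w [H [K [wU hH hK Hw Kw]]]] := tri_directed (tri_eltP u) (tri_eltP v).
by exists (to_elt wU, H, K).
Qed.

Definition gfrac_add (q r : gen_fractions) : gen_fractions :=
  let t := sval (tri_elt_directed (repr q).2 (repr r).2) in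
  gfrac (\det t.1.2 *: (repr q).1 + \det t.2 *: (repr r).1) t.1.1.

Definition gfrac_scale (a : R) (q : gen_fractions) : gen_fractions :=
  gfrac (a *: (repr q).1) (repr q).2.

Lemma gfrac_sameD m m' g g' w : gfrac m w = gfrac m' w -> gfrac g w = gfrac g' w ->
  gfrac (m + g) w = gfrac (m' + g') w.
Proof.
move=> /gfrac_sameP h /gfrac_sameP h'; apply/gfrac_sameP.
by rewrite opprD addrACA; apply: gfrac_nullD.
Qed.

Lemma gfrac_sameZ a m m' w : gfrac m w = gfrac m' w ->
  gfrac (a *: m) w = gfrac (a *: m') w.
Proof.
move=> /gfrac_sameP h; apply/gfrac_sameP.
by rewrite -scalerBr; apply: gfrac_nullZ.
Qed.

Lemma gfrac_add_same m g w : gfrac_add (gfrac m w) (gfrac g w) = gfrac (m + g) w.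
Proof.
rewrite /gfrac_add; case: tri_elt_directed => -[[w' H] K] /= [hH hK Hw Kw].
have := gfrac_reprK (gfrac m w); move: (repr _) Hw => [m' u'] /= Hw em.
have := gfrac_reprK (gfrac g w); move: (repr _) Kw => [g' v'] /= Kw eg.
have [[[t A] B] /= [hA hB At Bt]] := tri_elt_directed w' w.
rewrite (gfrac_push _ hA At) (gfrac_push _ hB Bt) !scalerDr.
apply: gfrac_sameD.
  rewrite -(gfrac_push _ hB Bt) -em scalerA -det_mulmx; apply/esym/gfrac_push.
    exact: trigM.
  by rewrite -mulmxA Hw.
rewrite -(gfrac_push _ hB Bt) -eg scalerA -det_mulmx; apply/esym/gfrac_push.
  exact: trigM.
by rewrite -mulmxA Kw.
Qed.

Lemma gfrac_scale_same a m w : gfrac_scale a (gfrac m w) = gfrac (a *: m) w.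
Proof.
rewrite /gfrac_scale.
have := gfrac_reprK (gfrac m w); case: (repr _) => [m' u'] /= em.
have [[[t A] B] /= [hA hB At Bt]] := tri_elt_directed u' w.
rewrite (gfrac_push _ hA At) (gfrac_push _ hB Bt) !scalerA.
rewrite ![\det _ * a]mulrC -!scalerA; apply: gfrac_sameZ.
by rewrite -(gfrac_push _ hB Bt) -(gfrac_push _ hA At).
Qed.

Lemma gfracW (Q : gen_fractions -> Prop) : (forall m u, Q (gfrac m u)) -> forall q, Q q.
Proof. by move=> h q; rewrite -[q]gfrac_reprK. Qed.

Lemma gfrac_common (q r : gen_fractions) :
  exists w m g, q = gfrac m w /\ r = gfrac g w.
Proof.
elim/gfracW: q => m u; elim/gfracW: r => g v.
have [[[w H] K] /= [hH hK Hw Kw]] := tri_elt_directed u v.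
exists w, (\det H *: m), (\det K *: g).
by rewrite -(gfrac_push _ hH Hw) -(gfrac_push _ hK Kw).
Qed.

Lemma gfrac_common3 (q r s : gen_fractions) :
  exists w m g l, [/\ q = gfrac m w, r = gfrac g w & s = gfrac l w].
Proof.
have [u [m [g [-> ->]]]] := gfrac_common q r.
elim/gfracW: s => l v.
have [[[w H] K] /= [hH hK Hw Kw]] := tri_elt_directed u v.
exists w, (\det H *: m), (\det H *: g), (\det K *: l).
by rewrite -!(gfrac_push _ hH Hw) -(gfrac_push _ hK Kw).
Qed.

Definition tri_point : tri_elt :=
  let s := cid (tri_nonempty U) in to_elt (svalP s).

Lemma gfrac0 u : gfrac 0 u = gfrac 0 tri_point.
Proof.
move: tri_point => v.
have [[[w H] K] /= [hH hK Hw Kw]] := tri_elt_directed u v.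
by rewrite (gfrac_push _ hH Hw) (gfrac_push _ hK Kw) !scaler0.
Qed.

Definition gfrac_opp (q : gen_fractions) : gen_fractions := gfrac_scale (-1) q.

Fact gfrac_addA : associative gfrac_add.
Proof.
move=> q r s; have [w [m [g [l [-> -> ->]]]]] := gfrac_common3 q r s.
by rewrite !gfrac_add_same addrA.
Qed.
Fact gfrac_addC : commutative gfrac_add.
Proof.
move=> q r; have [w [m [g [-> ->]]]] := gfrac_common q r.
by rewrite !gfrac_add_same addrC.
Qed.
Fact gfrac_add0 : left_id (gfrac 0 tri_point) gfrac_add.
Proof. by elim/gfracW=> m u; rewrite -(gfrac0 u) gfrac_add_same add0r. Qed.
Fact gfrac_addN : left_inverse (gfrac 0 tri_point) gfrac_opp gfrac_add.
Proof.
elim/gfracW=> m u; rewrite /gfrac_opp gfrac_scale_same gfrac_add_same.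
by rewrite scaleN1r addNr gfrac0.
Qed.
HB.instance Definition _ := GRing.isZmodule.Build gen_fractions
  gfrac_addA gfrac_addC gfrac_add0 gfrac_addN.

Fact gfrac_scaleA a b q : gfrac_scale a (gfrac_scale b q) = gfrac_scale (a * b) q.
Proof. by elim/gfracW: q => m u; rewrite !gfrac_scale_same scalerA. Qed.
Fact gfrac_scale1 : left_id 1 gfrac_scale.
Proof. by elim/gfracW=> m u; rewrite gfrac_scale_same scale1r. Qed.
Fact gfrac_scaleDr : right_distributive gfrac_scale gfrac_add.
Proof.
move=> a q r; have [w [m [g [-> ->]]]] := gfrac_common q r.
by rewrite !(gfrac_add_same, gfrac_scale_same) scalerDr.
Qed.
Fact gfrac_scaleDl q : {morph gfrac_scale^~ q : a b / a + b >-> gfrac_add a b}.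
Proof.
move=> a b; elim/gfracW: q => m u.
by rewrite !(gfrac_add_same, gfrac_scale_same) scalerDl.
Qed.
HB.instance Definition _ := GRing.Zmodule_isLmodule.Build R gen_fractions
  gfrac_scaleA gfrac_scale1 gfrac_scaleDr gfrac_scaleDl.

Lemma gfracD m u g v w H K : is_trig_mx H -> is_trig_mx K ->
  H *m val u = val w -> K *m val v = val w ->
  gfrac m u + gfrac g v = gfrac (\det H *: m + \det K *: g) w.
Proof.
move=> hH hK Hw Kw; rewrite (gfrac_push m hH Hw) (gfrac_push g hK Kw).
exact: gfrac_add_same.
Qed.

Lemma gfracZ a m u : a *: gfrac m u = gfrac (a *: m) u.
Proof. exact: gfrac_scale_same. Qed.

End GeneralizedFractions.

(* Main.v *)
(** Generalized fractions form the filtered colimit of the quotients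
    M / (u_1, ..., u_(n-1)) M, with transition maps |H|, and the Frobenius functor
    is right exact and commutes with colimits.  Hence F (U^-n M) is the module of
    generalized fractions of F M ~ M along the triangular set of the vectors
    (u_1^p, ..., u_n^p), which is cofinal in U.  Concretely, the inverse of kappa is
    r (x) m/u |-> r nu^-1 (1 (x) m) / u^p. *)

Require Import Defs.
From mathcomp Require Import all_boot all_order all_algebra.
From HB Require Import structures.
From mathcomp Require Import boolp ring.

Set Implicit Arguments.
Unset Strict Implicit.
Unset Printing Implicit Defensive.

Import GRing.Theory.
Local Open Scope ring_scope.

(** * Universal property and functoriality of base change *)

Section BaseChangeLift.
Variables (R S : comNzRingType) (phi : {rmorphism R -> S}) (M : lmodType R).

Lemma base_change_ind (Q : base_change phi M -> Prop) : Q 0 ->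
  (forall s m, Q (tensor phi s m)) ->
  (forall x y, Q x -> Q y -> Q (x + y)) -> forall x, Q x.
Proof. exact: tensor_ind. Qed.

Lemma tensors0 s : tensor phi s (0 : M) = 0.
Proof. by rewrite -(scale0r 0) -tensor_bal rmorph0 mulr0 -[0](mul0r 0) -tensorZ scale0r. Qed.

Lemma tensor_suml I (s : seq I) (P : pred I) (F : I -> S) (m : M) :
  tensor phi (\sum_(i <- s | P i) F i) m = \sum_(i <- s | P i) tensor phi (F i) m.
Proof.
elim/big_rec2: _ => [|i x y _ <-]; last exact: tensorDl.
by rewrite -[0](mul0r 0) -tensorZ scale0r.
Qed.

(** Evaluating formal sums in [N] respects every generator of [tensor_rel]: balancedness is matched
    by the [phi]-semilinearity of [f], the rest by additivity. *)
Lemma base_change_lift (N : lmodType S) (f : M -> N) :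
  {morph f : x y / x + y} -> (forall r m, f (r *: m) = phi r *: f m) ->
  exists g : {linear base_change phi M -> N},
    forall s m, g (tensor phi s m) = s *: f m.
Proof.
move=> fD fZ; pose ev (x : seq (S * M)) := \sum_(z <- x) z.1 *: f z.2.
have ev_rel x y : tensor_rel phi x y -> ev x = ev y.
  elim=> {x y} [x|x y _ ->|x y z _ -> _ ->|x x' y y' _ hx _ hy|x y|m|s s' m|s m m'|s r m] //.
  - by rewrite /ev !big_cat /= -/(ev x) -/(ev y) hx hy.
  - by rewrite /ev !big_cat /= addrC.
  - by rewrite /ev big_seq1 big_nil scale0r.
  - by rewrite /ev !(big_cons, big_nil) /= !addr0 scalerDl.
  - by rewrite /ev !(big_cons, big_nil) /= !addr0 fD scalerDr.
  - by rewrite /ev !big_seq1 fZ scalerA.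
pose g (q : base_change phi M) := ev (repr q).
have gE x : g (tensor_sum phi x) = ev x by apply/ev_rel/tensor_repr.
have gD : {morph g : x y / x + y}.
  elim/tensor_sumW=> x; elim/tensor_sumW=> y.
  by rewrite [_ + _]tensor_addE !gE /ev big_cat.
have gZ : scalable g.
  move=> a; elim/tensor_sumW=> x.
  rewrite [_ *: _]tensor_scaleE !gE /ev big_map scaler_sumr.
  by apply: eq_bigr => z _; rewrite scalerA.
have gL : linear g by move=> a x y; rewrite gD gZ.
pose G : {linear base_change phi M -> N} :=
  HB.pack g (GRing.isLinear.Build _ _ _ _ g gL).
by exists G => s m; rewrite [LHS]gE /ev big_seq1.
Qed.

Lemma base_change_map (N : lmodType R) (f : {linear M -> N}) :
  exists g : {linear base_change phi M -> base_change phi N},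
    forall s m, g (tensor phi s m) = tensor phi s (f m).
Proof.
have [|r m|g gE] := @base_change_lift (base_change phi N) (fun m => tensor phi 1 (f m)).
- by move=> x y; rewrite linearD tensorDr.
- by rewrite linearZ tensorZ mulr1 -tensor_bal mul1r.
by exists g => s m; rewrite gE tensorZ mulr1.
Qed.

End BaseChangeLift.

(** * Additive maps out of generalized fractions *)

Section GenFractionsLift.
Variables (R : comNzRingType) (n : nat) (U : triangular_set R n) (M : lmodType R).

Lemma gfracDr (u : tri_elt U) (x y : M) : gfrac (x + y) u = gfrac x u + gfrac y u.
Proof.
by rewrite (@gfracD _ _ _ _ _ u _ u u 1%:M 1%:M) ?trig1 ?mul1mx // det1 !scale1r.
Qed.

Lemma gfrac_linear (u : tri_elt U) : linear (fun m : M => gfrac m u).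
Proof. by move=> a x y; rewrite gfracDr gfracZ. Qed.

Lemma gfrac_wZ_eq0 (j : 'I_n) (m : M) (w : tri_elt U) :
  notlast j -> gfrac (val w j 0 *: m) w = 0.
Proof.
move=> jn; rewrite -[RHS](gfrac0 M w); apply/gfrac_sameP; rewrite subr0.
exact: gfrac_null_span (tri_eltP w) (in_span_gen _ _ jn).
Qed.

(** Universal property of the colimit: [f] respects the transition maps |H| and kills the w_j M
    divided out. Asking only for additivity lets it serve both the linear [kappa] and the
    Frobenius-semilinear map behind its inverse. *)
Lemma gfrac_lift (N : zmodType) (f : tri_elt U -> M -> N) :
  (forall u, {morph f u : x y / x + y}) ->
  (forall u w H m, is_trig_mx H -> H *m val u = val w -> f u m = f w (\det H *: m)) ->
  (forall w j m, notlast j -> f w (val w j 0 *: m) = 0) ->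
  exists2 g : gen_fractions U M -> N,
    {morph g : x y / x + y} & forall m u, g (gfrac m u) = f u m.
Proof.
move=> fD f_push f_null.
have f0 u : f u 0 = 0 by apply: (addIr (f u 0)); rewrite -fD !add0r.
have f_span w m : in_span (@notlast n) (val w) m -> f w m = 0.
  case=> b ->; elim/big_rec: _ => [//|j x jn hx].
  by rewrite fD hx f_null // addr0.
pose g (q : gen_fractions U M) := f (repr q).2 (repr q).1.
have gE m u : g (gfrac m u) = f u m.
  rewrite /g; have := gfrac_reprK (gfrac m u); case: (repr _) => m' u' /= /gfrac_eqP.
  move=> /asboolP[w [H [K [wU [hH hK] Hw Kw e]]]].
  (* Over the common denominator w, the two numerators differ by an element of the span that [f]
     kills. *)
  rewrite (f_push u' (to_elt wU) H) // (f_push u (to_elt wU) K) //.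
  have /f_span e0 : in_span (@notlast n) (val (to_elt wU)) (\det H *: m' - \det K *: m) := e.
  have := fD (to_elt wU) (\det H *: m' - \det K *: m) (\det K *: m).
  by rewrite subrK e0 add0r.
exists g => // q r; have [w [x [y [-> ->]]]] := gfrac_common q r.
by rewrite -gfracDr !gE fD.
Qed.

End GenFractionsLift.

(** * Frobenius on vectors and triangular matrices *)

Section FrobeniusPowers.
Variables (R : comNzRingType) (p n : nat) (charRp : p \in [pchar R]).
Local Notation frob := (pFrobenius_aut charRp).

Definition pow_vec (k : nat) (u : 'cV[R]_n) : 'cV[R]_n := \col_i u i 0 ^+ k.

Lemma pow_vec_tri (U : triangular_set R n) k u : (0 < k)%N -> U u -> U (pow_vec k u).
Proof. by move=> k0 uU; apply: (tri_pow uU (a := fun=> k)). Qed.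

Lemma map_frob_trig (H : 'M[R]_n) : is_trig_mx H -> is_trig_mx (map_mx frob H).
Proof.
move=> /is_trig_mxP hH; apply/is_trig_mxP => i j ij.
by rewrite mxE hH // rmorph0.
Qed.

Lemma map_frob_mul (H : 'M[R]_n) u : map_mx frob H *m pow_vec p u = pow_vec p (H *m u).
Proof.
have e v : pow_vec p v = map_mx frob v by apply/matrixP => i j; rewrite !mxE ord1.
by rewrite !e map_mxM.
Qed.

Lemma det_map_frob (H : 'M[R]_n) : \det (map_mx frob H) = \det H ^+ p.
Proof. by rewrite det_map_mx. Qed.

Lemma diag_pow_mul k u : diag (pow_vec k u) *m u = pow_vec k.+1 u.
Proof.
by apply/matrixP => i j; rewrite ord1 mul_diag_mx !mxE exprSr.
Qed.

Lemma det_diag_pow k u : \det (diag (pow_vec k u)) = \prod_i u i 0 ^+ k.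
Proof. by rewrite det_diagE; apply: eq_bigr => i _; rewrite mxE. Qed.

End FrobeniusPowers.

(** * Comparison of determinants inside the Frobenius functor *)

Section Kappa.
Variables (R : comNzRingType) (p n : nat) (charRp : p \in [pchar R]).
Variables (U : triangular_set R n) (M : lmodType R).
Local Notation tens := (frobenius_tensor charRp).

Let p_gt0 : (0 < p)%N := prime_gt0 (pcharf_prime charRp).

(** The shift to [k.+1] keeps the exponent positive, and makes the numerator in [gfrac_pow] gain
    exactly the product of the u_i^k. *)
Definition elt_pow (k : nat) (u : tri_elt U) : tri_elt U :=
  to_elt (pow_vec_tri (ltn0Sn k) (tri_eltP u)).

Lemma gfrac_pow k (m : M) (u : tri_elt U) :
  gfrac m u = gfrac ((\prod_i val u i 0 ^+ k) *: m) (elt_pow k u).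
Proof.
rewrite -det_diag_pow; apply: gfrac_push; first exact: trig_diag.
exact: diag_pow_mul.
Qed.

(** The p-th power crosses the tensor sign as w_j, and w_j m / w vanishes. *)
Lemma frobenius_tensor_wX_eq0 (j : 'I_n) r (m : M) (w : tri_elt U) : notlast j ->
  tens (r * val w j 0 ^+ p) (gfrac m w) = 0.
Proof.
by move=> jn; rewrite frobenius_tensor_bal gfracZ gfrac_wZ_eq0 // [LHS]tensors0.
Qed.

(* Both [diag (w^(p-1)) H] and [H^[p] diag (u^(p-1))] send u to w^p, so
   [trig_two_det] applies to their determinants; writing m / w as a
   fraction over w^2 provides the factor \prod_i w_i^p that it requires, and
   kills its conclusion, a combination of the w_j^(2p) with j not last. *)
Lemma frobenius_tensor_two_det (u w : tri_elt U) H r (m : M) :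
  is_trig_mx H -> H *m val u = val w ->
  tens ((\prod_i val u i 0 ^+ (p - 1)) * \det H ^+ p * r) (gfrac m w) =
  tens ((\prod_i val w i 0 ^+ (p - 1)) * \det H * r) (gfrac m w).
Proof.
move=> hH Hw; have p1 : (p - 1).+1 = p by rewrite subn1 prednK.
pose H1 := map_mx (pFrobenius_aut charRp) H *m diag (pow_vec (p - 1) (val u)).
pose H2 := diag (pow_vec (p - 1) (val w)) *m H.
have H1u : H1 *m val u = pow_vec p (val w).
  by rewrite -mulmxA diag_pow_mul p1 map_frob_mul Hw.
have H2u : H2 *m val u = pow_vec p (val w) by rewrite -mulmxA Hw diag_pow_mul p1.
have hH1 : is_trig_mx H1 by apply: trigM; [apply: map_frob_trig | apply: trig_diag].
have hH2 : is_trig_mx H2 by apply: trigM => //; apply: trig_diag.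
have [b] := trig_two_det (1 : R^o) hH1 hH2 H1u H2u.
rewrite -scalerBl /H1 /H2 !det_mulmx det_map_frob !det_diag_pow diag_mul.
rewrite [_ ^+ p * _]mulrC; set D1 := _ * _ ^+ p; set D2 := _ * \det H => e.
have D0 : tens ((D1 - D2) * r) (gfrac m w) = 0.
  rewrite (gfrac_pow 1) -gfracZ -frobenius_tensor_bal.
  have -> : (D1 - D2) * r * (\prod_i val w i 0 ^+ 1) ^+ p =
      \sum_(j < n | notlast j) r * b j * val (elt_pow 1 w) j 0 ^+ p.
    transitivity ((\prod_i val w i 0 ^+ p) *: ((D1 - D2) *: (1 : R^o)) * r).
      rewrite /GRing.scale /= mulr1 -prodrXl.
      under eq_bigr do rewrite expr1.
      by rewrite mulrC mulrA.
    rewrite e mulr_suml; apply: eq_bigr => j _.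
    by rewrite !mxE /GRing.scale /= -!exprM mulnC; ring.
  rewrite [LHS]tensor_suml big1 // => j jn; exact: frobenius_tensor_wX_eq0.
apply/eqP; rewrite -subr_eq0; apply/eqP; rewrite -[RHS]D0 mulrBl.
by rewrite -[X in _ - X]scale1r -scaleNr tensorZ mulN1r -tensorDl.
Qed.

End Kappa.

(** * The structural isomorphism and its inverse *)

Lemma F_inv_linear (R : comNzRingType) (p : nat) (charRp : p \in [pchar R])
  (M : lmodType R) (nu : F_structure charRp M) : linear (F_inv nu).
Proof. exact: can2_linear (F_isoK nu) (F_invK nu). Qed.

Theorem theorem3p4 (R : comNzRingType) (p n : nat)
  (R_regular : regular_ring R) (charRp : p \in [pchar R]) (n_gt0 : (0 < n)%N)
  (U : triangular_set R n) (M : lmodType R) (nu : F_structure charRp M) :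
  exists kappa : F_structure charRp (gen_fractions U M),
    forall (u : tri_elt U) (h : nat) (r : 'I_h -> R) (m : 'I_h -> M),
      (0 < h)%N ->
      kappa (gfrac (F_inv nu (\sum_(i < h) frobenius_tensor charRp (r i) (m i))) u) =
      \sum_(i < h) frobenius_tensor charRp
        ((\prod_(j < n) val u j 0 ^+ (p - 1)) * r i) (gfrac (m i) u).
Proof.
have p_gt0 : (0 < p)%N := prime_gt0 (pcharf_prime charRp).
have p1 : (p - 1).+1 = p by rewrite subn1 prednK.
pose frob := pFrobenius_aut charRp.
pose N := gen_fractions U M.
pose FN := frobenius_functor charRp N.
pose inv : {linear frobenius_functor charRp M -> M} :=
  HB.pack (F_inv nu) (GRing.isLinear.Build _ _ _ _ _ (F_inv_linear nu)).
have nuK x : inv (nu x) = x := F_isoK nu x.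
have invK x : nu (inv x) = x := F_invK nu x.
pose C (u : tri_elt U) := \prod_j val u j 0 ^+ (p - 1).
(* [J u] is the Frobenius functor applied to the map m |-> m/u. *)
have /choice[J JE] (u : tri_elt U) : exists f : {linear frobenius_functor charRp M -> FN},
    forall r m, f (frobenius_tensor charRp r m) = frobenius_tensor charRp r (gfrac m u).
  pose gu : {linear M -> N} :=
    HB.pack (fun m => gfrac m u) (GRing.isLinear.Build _ _ _ _ _ (gfrac_linear u)).
  exact: (base_change_map frob gu).
have [|u w H m hH Hw|w j m jn|kap kapD kapE] :=
    @gfrac_lift _ _ U M FN (fun u m => C u *: J u (nu m)).
- by move=> u x y; rewrite (linearD nu) (linearD (J u)) scalerDr.
- rewrite (linearZ_LR nu) (linearZ_LR (J w)) scalerA.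
  elim/base_change_ind: (nu m) => [|r {}m|x y hx hy].
  + by rewrite !linear0 ?scaler0.
  + rewrite -[tensor _ _ _]/(frobenius_tensor charRp r m) !JE.
    (* On the left, |H| leaves the tensor as |H|^p, while linearity of [nu] gives only |H| on the
       right; [frobenius_tensor_two_det] reconciles them. *)
    rewrite (gfrac_push _ hH Hw) -gfracZ -frobenius_tensor_bal !tensorZ.
    rewrite -[RHS](frobenius_tensor_two_det charRp r m hH Hw).
    by rewrite -!mulrA [r * _]mulrC.
  + by rewrite (linearD (J u)) (linearD (J w)) !scalerDr hx hy.
- rewrite (linearZ_LR nu) (linearZ_LR (J w)) scalerA.
  elim/base_change_ind: (nu m) => [|r {}m|x y hx hy].
  + by rewrite !linear0 ?scaler0.
  + rewrite -[tensor _ _ _]/(frobenius_tensor charRp r m) !JE tensorZ.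
    (* The factor w_j^(p-1) of [C w] completes w_j to w_j^p. *)
    rewrite /C (bigD1 j) //= [_ * val w j 0]mulrAC -exprSr p1 -mulrA mulrC.
    exact: frobenius_tensor_wX_eq0.
  + by rewrite (linearD (J w)) scalerDr hx hy addr0.
have kap_lin : linear kap.
  move=> a q y; rewrite kapD; congr (_ + _); elim/gfracW: q => m u.
  by rewrite gfracZ !kapE (linearZ_LR nu) (linearZ_LR (J u)) !scalerA mulrC.
pose kappa : {linear N -> FN} := HB.pack kap (GRing.isLinear.Build _ _ _ _ _ kap_lin).
have kappaE m u : kappa (gfrac m u) = C u *: J u (nu m) := kapE m u.
pose pw (u : tri_elt U) : tri_elt U := to_elt (pow_vec_tri p_gt0 (tri_eltP u)).
pose t1 m := frobenius_tensor charRp 1 m : frobenius_functor charRp M.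
have t1Z a m : t1 (a *: m) = a ^+ p *: t1 m.
  by rewrite /t1 -frobenius_tensor_bal tensorZ mulr1 mul1r.
have gfrac_pw m u : gfrac m u = C u *: gfrac m (pw u) :> N.
  rewrite (gfrac_pow (p - 1)) gfracZ.
  by congr gfrac; apply: val_inj; rewrite /= p1.
have t1D x y : t1 (x + y) = t1 x + t1 y := tensorDr _ _ _ _.
have pwE u j : val (pw u) j 0 = val u j 0 ^+ p by rewrite mxE.
(* The inverse on the tensors 1 (x) m/u. It respects transition maps because [t1] turns |H| into
   |H|^p, the determinant of the entrywise Frobenius of H, which sends u^p to w^p. *)
have [|u w H m hH Hw|w j m jn|l lD lE] :=
    @gfrac_lift _ _ U M N (fun u m => gfrac (inv (t1 m)) (pw u)).
- by move=> u x y; rewrite t1D linearD gfracDr.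
- rewrite t1Z linearZ_LR -(det_map_frob charRp); apply: gfrac_push.
    exact: map_frob_trig.
  by rewrite /= map_frob_mul Hw.
- by rewrite t1Z linearZ_LR -pwE gfrac_wZ_eq0.
have [|lam lamE] := @base_change_lift _ _ frob N N l lD.
  move=> a; elim/gfracW=> m u.
  by rewrite gfracZ !lE t1Z linearZ_LR gfracZ.
have {lE} lamE r m u :
    lam (frobenius_tensor charRp r (gfrac m u)) = r *: gfrac (inv (t1 m)) (pw u).
  by rewrite lamE lE.
(* Applied to [nu m], this gives m/u^p, and the factor [C u] in [kappa] turns it back into m/u. *)
have lamJ x u : lam (J u x) = gfrac (inv x) (pw u).
  elim/base_change_ind: x => [|r m|x y hx hy].
  - by rewrite !linear0 gfrac0.
  - rewrite -[tensor _ _ _]/(frobenius_tensor charRp r m) JE lamE gfracZ.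
    by rewrite -linearZ_LR tensorZ mulr1.
  - by rewrite (linearD (J u)) (linearD lam) (linearD inv) gfracDr hx hy.
have kapK : cancel kappa lam.
  elim/gfracW=> m u.
  by rewrite kappaE linearZ_LR lamJ nuK -gfrac_pw.
have lamK : cancel lam kappa.
  elim/base_change_ind=> [|r q|x y hx hy].
  - by rewrite !linear0.
  - rewrite -[tensor _ _ _]/(frobenius_tensor charRp r q); elim/gfracW: q => m u.
    rewrite lamE linearZ_LR kappaE invK JE !tensorZ mulr1.
    (* Rewriting m/u over u^p moves [C u] out of the tensor as its p-th power, which is
       [C (pw u)]. *)
    rewrite [in RHS]gfrac_pw -frobenius_tensor_bal.
    congr (frobenius_tensor charRp (r * _)); rewrite /C -prodrXl.
    by apply: eq_bigr => j _; rewrite pwE -!exprM mulnC.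
  - by rewrite (linearD lam) (linearD kappa) hx hy.
exists (FStructure kapK lamK) => u h r m _.
rewrite [LHS]kappaE F_invK linear_sum scaler_sumr.
by apply: eq_bigr => i _; rewrite JE tensorZ.
Qed.
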